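(* For all integers $k \ge 2$, $r \ge 3$ and every real $\varepsilon > 0$ there exists $n_0(r,k,\varepsilon) \in \mathbb{N}$ such that for all integers $n \ge n_0(r,k,\varepsilon)$ we have \[ f(r,k;n) \le 3^{\frac13 r (k - 1 + \varepsilon) \binom{n}{\lfloor n/2 \rfloor}}. \] Moreover, if $r(k-1)$ is divisible by three, then (for all such $n$) \[ f(r,k;n) \ge 3^{\frac13 r (k - 1 - \varepsilon) \binom{n}{\lfloor n/2 \rfloor}} \] as well.
   Context: $[n] = \{1,\dots,n\}$ and $2^{[n]}$ is the family of all subsets of $[n]$. A $k$-chain is a collection of $k$ distinct sets $F_1 \subset F_2 \subset \cdots \subset F_k$ (strict containments). Given a family $\mathcal{F} \subseteq 2^{[n]}$, an $(r,k)$-colouring of $\mathcal{F}$ is an $r$-colouring of the sets in $\mathcal{F}$ (a map from $\mathcal{F}$ to a fixed set of $r$ colours, not necessarily surjective) such that there is no monochromatic $k$-chain consisting of members of $\mathcal{F}$. For $r \ge 2$ and $n \ge k \ge 2$, $f(r,k;n)$ denotes the maximum, over all families $\mathcal{F} \subseteq 2^{[n]}$, of the number of $(r,k)$-colourings of $\mathcal{F}$. *)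

(* Defs.v *)
From mathcomp Require Import all_boot.

Set Implicit Arguments.
Unset Strict Implicit.
Unset Printing Implicit Defensive.

Section Colourings.

Variables (n r k : nat).

(* The ground set [n] is represented by 'I_n = {0, ..., n - 1}. *)
Implicit Type F : {set {set 'I_n}}.

Definition is_chain F (t : k.-tuple {A : {set 'I_n} | A \in F}) : bool :=
  sorted (fun A B : {A : {set 'I_n} | A \in F} => val A \proper val B) t.

Definition monochromatic F (c : {ffun {A : {set 'I_n} | A \in F} -> 'I_r})
    (t : k.-tuple {A : {set 'I_n} | A \in F}) : bool :=
  constant (map c t).

(* Colourings are defined on the members of F only, so that maps agreeing on
   F are not counted several times. *)
Definition rk_colouring F
    (c : {ffun {A : {set 'I_n} | A \in F} -> 'I_r}) : bool :=
  [forall t : k.-tuple {A : {set 'I_n} | A \in F},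
    is_chain t ==> ~~ monochromatic c t].

Definition nb_rk_colourings F : nat :=
  #|[set c : {ffun {A : {set 'I_n} | A \in F} -> 'I_r} | rk_colouring c]|.

End Colourings.

Definition max_rk_colourings (r k n : nat) : nat :=
  \max_(F : {set {set 'I_n}}) nb_rk_colourings r k F.

(* Main.v *)
Require Import Defs.
From mathcomp Require Import all_boot all_order all_algebra.
From mathcomp Require Import reals sequences exp.
From mathcomp Require Import zify ring lra.
Import Order.TTheory GRing.Theory Num.Theory.
Set Implicit Arguments.
Unset Strict Implicit.
Unset Printing Implicit Defensive.
Local Open Scope ring_scope.

(** Write N for the central binomial coefficient 'C(n, n %/ 2).

    Upper bound.  In an (r, k+1)-colouring of F every colour class contains no
    (k+1)-chain, hence splits by height into k antichains
    ([chain_free_height]).  Antichains have few small containers: for every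
    fixed delta > 0 and all large n there is a map K such that each antichain lies in
    some K(S) of size at most (1 + delta) N, where the fingerprint S is a family
    of O(2^n / n) sets ([antichain_containers]).  So every colouring has r * k
    fingerprints.  Conversely, once these are fixed, each A in F may only
    receive one of the d(A) colours that have a container containing A, and the d(A) sum
    to at most r k (1 + delta) N.  As d^3 <= 3^d for every natural number d, the
    product of the d(A) is at most 3 to the power r k (1 + delta) N / 3
    ([rk_colourings_containers]).  Since N is of order 2^n / sqrt n, the number
    of fingerprints, exp(O(2^n log n / n)), is 3^(o(N))
    ([fingerprints_negligible]), so that the choice of the r * k fingerprints
    costs only another factor 3^(o(N)).

    The containers come from the Kleitman-Winston argument in the comparability
    graph on the nonempty sets.  It requires that every family with at least
    (1 + delta) N nonempty sets has a member comparable to at least c n others,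
    with c > 0 depending on delta
    ([comparable_supersaturation]).  To see this, let X be the number of members
    of the family on a uniformly random maximal chain; then X - 'C(X, 2) <= 1,
    and taking expectations bounds the sum of the 1 / 'C(n, #|B|) by 1 plus the
    sum, over the comparable pairs, of the probability that the chain passes
    through both members ([chain_inclusion_exclusion]).  The latter is at most
    2 / n times the sum of the probabilities of the two members
    ([pair_prob_bound]), so it can be charged to the degrees.

    Lower bound.  If 3 m = r k, take the m consecutive layers from the middle
    one upwards and give each of them a list of three colours in such a way
    that each colour is in the lists of at most k layers.  A monochromatic chain
    then has at most k members, so all the choices from the lists are
    colourings ([middle_layers_colourings]); and each of the m layers has size
    (1 - o(1)) N ([bin_near_half]). *)

(** * Binomial coefficients *)

Section Binomials.
Local Open Scope nat_scope.

Lemma leq_bin_interior a b : 0 < a < b -> b <= 'C(b, a).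
Proof.
elim: b a => [|b IHb] [|a] // /andP[_]; rewrite ltnS => lt_ab.
case: a lt_ab => [|a] lt_ab; first by rewrite bin1.
have [eq_b|ne_b] := eqVneq a.+2 b; first by rewrite -eq_b binSn.
have : b <= 'C(b, a.+2) by apply: IHb; rewrite /= ltn_neqAle ne_b.
have : 0 < 'C(b, a.+1) by rewrite bin_gt0 ltnW.
by rewrite binS; lia.
Qed.

Lemma mul_bin_trinomial a b n : a <= b -> b <= n ->
  'C(n, b) * 'C(b, a) = 'C(n, a) * 'C(n - a, b - a).
Proof.
move=> le_ab le_bn; have le_an := leq_trans le_ab le_bn.
have fact_neq0 : 0 < a`! * (b - a)`! * (n - b)`! by rewrite !muln_gt0 !fact_gt0.
apply/eqP; rewrite -(eqn_pmul2r fact_neq0); apply/eqP.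
have eq_nb : n - a - (b - a) = n - b by lia.
transitivity n`!.
  by rewrite -(bin_fact le_bn) -(bin_fact le_ab); ring.
by rewrite -(bin_fact le_an) -(bin_fact (leq_sub2r a le_bn)) eq_nb; ring.
Qed.

Lemma leq_bin_half n a : 'C(n, a) <= 'C(n, n %/ 2).
Proof.
have half d : d <= n %/ 2 -> 'C(n, n %/ 2 - d) <= 'C(n, n %/ 2).
  elim: d => [|d IHd] le_d; first by rewrite subn0.
  apply: leq_trans (IHd (ltnW le_d)).
  have := mul_bin_left n (n %/ 2 - d.+1).
  have -> : (n %/ 2 - d.+1).+1 = n %/ 2 - d by lia.
  set x := 'C(n, _); set y := 'C(n, _) => eq_xy.
  have : (n %/ 2 - d) * y <= (n %/ 2 - d) * x.
    by rewrite eq_xy leq_mul2r; apply/orP; right; lia.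
  by rewrite leq_pmul2l //; lia.
(* The upper half reduces to the lower one by symmetry. *)
have [le_a|gt_a] := leqP a (n %/ 2).
  by have := half (n %/ 2 - a); rewrite subKn //; apply; rewrite leq_subr.
have [le_an|/bin_small-> //] := leqP a n.
rewrite -bin_sub //.
have := half (n %/ 2 - (n - a)); rewrite subKn.
  by apply; rewrite leq_subr.
lia.
Qed.

Lemma central_bin_double h : 0 < h -> 16 ^ h <= 4 * h * 'C(h.*2, h) ^ 2.
Proof.
elim: h => [//|[|h] IHh _]; first by [].
have {}IHh := IHh isT.
have step : h.+2 * 'C(h.+2.*2, h.+2) = 2 * (h.+1.*2.+1) * 'C(h.+1.*2, h.+1).
  have e1 : (2 * h.+2) * 'C(h.+1.*2.+1, h.+1) = h.+2 * 'C(h.+2.*2, h.+2).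
    by rewrite mul2n -[h.+2.*2]/(h.+1.*2.+2) -mul_bin_diag.
  have e2 : h.+1.*2.+1 * 'C(h.+1.*2, h.+1) = h.+2 * 'C(h.+1.*2.+1, h.+1).
    by rewrite (mul_bin_down h.+1.*2.+1); congr (_ * _); lia.
  by rewrite -e1 -mulnA -e2 mulnA.
set x := 'C(h.+1.*2, h.+1) in IHh step *; set y := 'C(h.+2.*2, h.+2) in step *.
rewrite -(leq_pmul2l (m := h.+2)) // expnS.
have -> : h.+2 * (4 * h.+2 * y ^ 2) = 4 * (h.+2 * y) ^ 2 by ring.
rewrite step.
apply: (@leq_trans (h.+2 * (16 * (4 * h.+1 * x ^ 2)))).
  by rewrite !leq_mul2l IHh !orbT.
have -> : h.+2 * (16 * (4 * h.+1 * x ^ 2)) = 16 * (4 * (h.+2 * h.+1)) * x ^ 2.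
  by ring.
have -> : 4 * (2 * h.+1.*2.+1 * x) ^ 2 = 16 * (h.+1.*2.+1 ^ 2) * x ^ 2 by ring.
rewrite leq_mul2r leq_mul2l; apply/orP; right; rewrite /=; nia.
Qed.

(** The central binomial coefficient is at least 2^n / sqrt (2 (n + 1)). *)
Lemma central_bin_lower n : 0 < n -> 4 ^ n <= 2 * n.+1 * 'C(n, n %/ 2) ^ 2.
Proof.
move=> n_gt0; rewrite divn2.
have [n_odd|n_even] := boolP (odd n); last first.
  have eq_n : n = n./2.*2 by rewrite even_halfK.
  have h_gt0 : 0 < n./2 by lia.
  have := central_bin_double h_gt0; rewrite -eq_n.
  have -> : 16 ^ n./2 = 4 ^ n by rewrite [in RHS]eq_n -mul2n expnM.
  move/leq_trans; apply; rewrite leq_mul2r; apply/orP; right; lia.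
(* For n = 2h+1, 'C(n, h) is half of 'C(2h+2, h+1). *)
have eq_n : n = n./2.*2.+1 by rewrite -[LHS]odd_double_half n_odd.
set h := n./2 in eq_n *.
have := @central_bin_double h.+1 isT.
have -> : 16 ^ h.+1 = 4 * 4 ^ n by rewrite eq_n -expnS -doubleS -mul2n expnM.
have -> : 'C(h.+1.*2, h.+1) = 2 * 'C(n, h).
  rewrite doubleS -eq_n binS.
  have -> : 'C(n, h.+1) = 'C(n, h).
    by rewrite -bin_sub ?eq_n; [congr 'C(_, _); lia | lia].
  by rewrite mul2n addnn.
rewrite expnMn => le4; have : 4 * 4 ^ n <= 4 * (2 * n.+1 * 'C(n, h) ^ 2).
  apply: leq_trans le4 _.
  have -> : 4 * h.+1 * (2 ^ 2 * 'C(n, h) ^ 2) = 4 * (4 * h.+1 * 'C(n, h) ^ 2).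
    by ring.
  by rewrite leq_mul2l leq_mul2r; apply/orP; right; apply/orP; right; lia.
by rewrite leq_pmul2l.
Qed.

End Binomials.

(** * Comparable pairs in families larger than a layer *)

Section Supersaturation.
Variable T : finType.
Implicit Types (A B S : {set T}) (F : {set {set T}}).

(** For B a subset of S, the probability that a uniformly random maximal chain
    of subsets of S passes through B. *)
Definition chain_prob S B : rat := ('C(#|S|, #|B|)%:R)^-1.

(** Strict comparability: a set is not comparable to itself. *)
Definition set_comparable A B := (A \proper B) || (B \proper A).

Lemma chain_prob_ge0 S B : 0 <= chain_prob S B.
Proof. by rewrite invr_ge0. Qed.

Lemma chain_probSS S : chain_prob S S = 1.
Proof. by rewrite /chain_prob binn invr1. Qed.

(** A random maximal chain of S is a random x in S followed by a random maximal
    chain of S :\ x. *)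
Lemma chain_prob_proper (phi : {set T} -> rat) S :
  #|S|%:R * \sum_(B : {set T} | B \proper S) phi B * chain_prob S B =
  \sum_(x in S) \sum_(B : {set T} | B \subset S :\ x)
     phi B * chain_prob (S :\ x) B.
Proof.
rewrite mulr_sumr.
under [RHS]eq_bigr do rewrite big_mkcond.
rewrite exchange_big /= big_mkcond; apply: eq_bigr => B _.
have [BS|nBS] := boolP (B \proper S); last first.
  rewrite big1 // => x xS; case: ifP => // BSx.
  by case/negP: nBS; apply: sub_proper_trans BSx (properD1 xS).
have [BsubS lt_BS] := (proper_sub BS, proper_card BS).
rewrite -big_mkcondr /= (eq_bigl (mem (S :\: B))); last first.
  move=> x; rewrite !inE subsetD1 BsubS /= andbC.
  by case: (x \in B).
rewrite (eq_bigr (fun=> phi B * ('C(#|S|.-1, #|B|)%:R)^-1)); last first.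
  move=> x; rewrite !inE => /andP[_ xS].
  by rewrite /chain_prob [#|S|](cardsD1 x) xS.
rewrite sumr_const cardsD (setIidPr BsubS) /chain_prob.
have := mul_bin_down #|S| #|B|.
have : (0 < 'C(#|S|, #|B|))%N by rewrite bin_gt0 ltnW.
have : (0 < 'C(#|S|.-1, #|B|))%N by rewrite bin_gt0; lia.
move: 'C(_, _) 'C(_, _) (#|S| - #|B|)%N => u v d u_gt0 v_gt0 eq_uv.
rewrite -[RHS]mulr_natl mulrCA [RHS]mulrCA; congr (_ * _).
have u_neq0 : u%:R != 0 :> rat by rewrite pnatr_eq0 -lt0n.
have v_neq0 : v%:R != 0 :> rat by rewrite pnatr_eq0 -lt0n.
apply: (mulIf u_neq0); apply: (mulIf v_neq0); rewrite mulfVK //.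
by rewrite mulrAC mulfVK // -!natrM eq_uv.
Qed.

(** If X is the number of members of F on a random maximal chain of subsets
    of S, the left-hand side is the expectation of X - 'C(X, 2). *)
Lemma chain_inclusion_exclusion F S :
  \sum_(B in F | B \subset S)
    (1 - \sum_(A in F | A \proper B) chain_prob B A) * chain_prob S B <= 1.
Proof.
have [m] := ubnP #|S|; elim: m S => // m IHm S; rewrite ltnS => le_Sm.
pose h B := 1 - \sum_(A in F | A \proper B) chain_prob B A.
rewrite -[leLHS]/(\sum_(B in F | B \subset S) h B * chain_prob S B).
pose phi B := if B \in F then h B else 0.
have sum_phi (P : pred {set T}) S' :
    \sum_(B in F | P B) h B * chain_prob S' B =
    \sum_(B : {set T} | P B) phi B * chain_prob S' B.
  rewrite big_mkcondl; apply: eq_bigr => B _; rewrite /phi.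
  by case: ifP; rewrite ?mul0r.
(* If S is in F, the pairs with larger member S already compensate for all the
   members of F other than S; otherwise the claim is an average of its instances
   for the sets S :\ x. *)
have [SF|nSF] := boolP (S \in F).
  rewrite (bigD1 S) /=; last by rewrite SF subxx.
  rewrite chain_probSS mulr1 {1}/h.
  rewrite (eq_bigl (fun B => (B \in F) && (B \proper S))); last first.
    by move=> B; rewrite properEneq -andbA [(B != S) && _]andbC.
  rewrite addrAC -addrA gerDl subr_le0; apply: ler_sum => B _.
  rewrite -[leRHS]mul1r ler_wpM2r ?chain_prob_ge0 // gerBl.
  by apply: sumr_ge0 => A _; apply: chain_prob_ge0.
rewrite sum_phi (bigD1 S) //= {1}/phi (negPf nSF) mul0r add0r.
rewrite (eq_bigl (fun B => B \proper S)); last first.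
  by move=> B; rewrite properEneq andbC.
have [S0|S_gt0] := posnP #|S|.
  rewrite big1 // => B /proper_card; rewrite S0 //.
have nS_gt0 : 0 < #|S|%:R :> rat by rewrite ltr0n.
rewrite -(ler_pM2l nS_gt0) chain_prob_proper mulr1.
rewrite -[leRHS]/(_ *+ _) -sumr_const; apply: ler_sum => x xS.
rewrite -sum_phi; apply: IHm.
by rewrite (cardsD1 x) xS in le_Sm.
Qed.

(** The left-hand side is n times the probability that a random maximal chain
    of an n-set passes through two given nested sets of sizes a and b.  One of
    the conditional probabilities 1 / 'C(b, a) and 1 / 'C(n - a, b - a) is at
    most 2 / n, according to the half in which b lies. *)
Lemma pair_prob_bound n a b : (0 < a)%N -> (a < b)%N -> (b <= n)%N ->
  n%:R * ('C(n, b)%:R^-1 * 'C(b, a)%:R^-1)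
    <= 2 * ('C(n, a)%:R^-1 + 'C(n, b)%:R^-1) :> rat.
Proof.
move=> a_gt0 lt_ab le_bn.
have aux (x y : nat) : (0 < x)%N -> (0 < y)%N -> (n <= 2 * y)%N ->
    n%:R * (x%:R^-1 * y%:R^-1) <= 2 * x%:R^-1 :> rat.
  move=> x_gt0 y_gt0 le_ny; rewrite mulrCA mulrC ler_wpM2r ?invr_ge0 //.
  by rewrite ler_pdivrMr ?ltr0n // -natrM ler_nat.
have bin0 x y : (y <= x)%N -> (0 < 'C(x, y))%N by rewrite bin_gt0.
have [le_nb|gt_nb] := leqP n (2 * b).
  apply: le_trans (aux _ _ (bin0 _ _ le_bn) (bin0 _ _ (ltnW lt_ab)) _) _.
    apply: leq_trans le_nb _; rewrite leq_mul2l leq_bin_interior //.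
    by rewrite a_gt0.
  by rewrite ler_pM2l // lerDr invr_ge0.
rewrite -invfM -natrM mul_bin_trinomial ?(ltnW lt_ab) // natrM invfM.
apply: (le_trans (aux _ _ _ _ _)); rewrite ?bin0 //; try lia.
  have : (n - a <= 'C(n - a, b - a))%N by apply: leq_bin_interior; lia.
  lia.
by rewrite ler_pM2l // lerDl invr_ge0.
Qed.

(** The empty set is left out because the estimate of [pair_prob_bound] fails,
    for n > 4, for the pair formed by the empty set and the whole n-set. *)
Lemma comparable_supersaturation F D : set0 \notin F ->
  (forall A, A \in F -> (#|[set B in F | set_comparable A B]| <= D)%N) ->
  (#|F| * (#|T| - 2 * D) <= #|T| * 'C(#|T|, #|T| %/ 2))%N.
Proof.
move=> F0 degF; set n := #|T|.
have [le_n|lt_n] := leqP n (2 * D); first by rewrite (eqP le_n) muln0.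
have n_gt0 : 0 < n%:R :> rat by rewrite ltr0n; lia.
pose w B := chain_prob setT B.
have pairs :
  n%:R * \sum_(B in F) \sum_(A in F | A \proper B) w B * chain_prob B A
    <= 2 * D%:R * \sum_(B in F) w B.
  apply: (@le_trans _ _ (\sum_(B in F) \sum_(A in F | A \proper B)
                           2 * (w A + w B))).
    rewrite mulr_sumr; apply: ler_sum => B BF; rewrite mulr_sumr.
    apply: ler_sum => A /andP[AF AB].
    rewrite /w /chain_prob cardsT; apply: pair_prob_bound.
    - by rewrite card_gt0; apply: contraNneq F0 => <-.
    - exact: proper_card.
    - exact: max_card.
  rewrite -mulrA.
  under eq_bigr do rewrite -mulr_sumr.
  rewrite -mulr_sumr ler_pM2l //.
  (* Each member of F is charged by the pairs below it and by those above it. *)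
  have -> : \sum_(B in F) \sum_(A in F | A \proper B) (w A + w B) =
      \sum_(B in F) \sum_(A in F | set_comparable B A) w B.
    under eq_bigr do rewrite big_split /=.
    rewrite big_split /= (exchange_big_dep (mem F)) /=; last first.
      by move=> B A _ /andP[].
    rewrite -big_split /=; apply: eq_bigr => B BF.
    rewrite [RHS](bigID (fun A => B \proper A)) /=; congr (_ + _).
      apply: eq_bigl => A; rewrite BF /set_comparable.
      by case: (A \in F) (B \proper A) => [] [] //=; rewrite andbF.
    apply: eq_bigl => A; rewrite /set_comparable; case: (A \in F) => //=.
    by case BA: (B \proper A); case AB: (A \proper B) => //=;
       case/negP: (proper_irrefl A); apply: proper_trans AB BA.
  rewrite mulr_sumr; apply: ler_sum => B BF.
  rewrite sumr_const -[leLHS]mulr_natl ler_wpM2r ?chain_prob_ge0 // ler_nat.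
  by apply: leq_trans (degF B BF); rewrite subset_leq_card //;
     apply/subsetP => A; rewrite inE.
have := chain_inclusion_exclusion F setT.
under eq_bigl do rewrite subsetT andbT.
under eq_bigr do rewrite mulrBl mul1r mulr_suml.
rewrite sumrB; under [X in _ - X]eq_bigr do under eq_bigr do rewrite mulrC.
rewrite -/w; set p := (X in _ - X) in pairs * => le1.
have wsum : (n%:R - 2 * D%:R) * \sum_(B in F) w B <= n%:R.
  have := ler_wpM2l (ltW n_gt0) le1; rewrite mulr1 mulrBr mulrBl => le_n.
  by apply: le_trans le_n; rewrite lerD2l lerN2.
have bin0 x y : (y <= x)%N -> 0 < 'C(x, y)%:R :> rat.
  by rewrite ltr0n bin_gt0.
have c_gt0 := bin0 n (n %/ 2)%N (leq_div _ _).
have wF : #|F|%:R / 'C(n, n %/ 2)%:R <= \sum_(B in F) w B.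
  rewrite mulr_natl -sumr_const; apply: ler_sum => B _.
  rewrite /w /chain_prob cardsT lef_pV2 ?posrE ?c_gt0 ?bin0 ?max_card //.
  by rewrite ler_nat leq_bin_half.
rewrite -(ler_nat rat) !natrM natrB ?(ltnW lt_n) // natrM.
rewrite -ler_pdivrMr // mulrAC mulrC; apply: le_trans wsum.
by rewrite ler_wpM2l // subr_ge0 -natrM ler_nat ltnW.
Qed.

End Supersaturation.

(** * Containers *)

Section Containers.
Local Open Scope nat_scope.

(** Kleitman-Winston containers for the independent sets of a graph in which
    every set of more than M vertices has a vertex with more than D neighbours
    inside it.  The fingerprint S of I consists of the high-degree vertices
    picked in I; each of them eliminates at least D vertices. *)
Lemma independent_containers (V : finType) (adj : rel V) (U : {set V}) D M :
    (forall F : {set V}, F \subset U -> M < #|F| ->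
       exists2 v, v \in F & D < #|[set u in F | adj v u]|) ->
  exists2 g : {set V} -> {set V}, forall S, #|g S| <= M &
    forall I : {set V}, I \subset U -> {in I &, forall u v, ~~ adj u v} ->
    exists S : {set V},
      [/\ S \subset I, #|S| * D <= #|U| & I \subset S :|: g S].
Proof.
move=> deg.
suff ind m (F : {set V}) : F \subset U -> #|F| <= m ->
  exists2 g : {set V} -> {set V}, forall S, #|g S| <= M &
    forall I : {set V}, I \subset F -> {in I &, forall u v, ~~ adj u v} ->
    exists S : {set V},
      [/\ S \subset I, #|S| * D <= #|F| & I \subset S :|: g S].
  exact: ind (leqnn #|U|).
elim: m F => [|m IHm] F FU le_Fm; (have [le_FM|lt_MF] := leqP #|F| M; first
  by exists (fun=> F) => // I IF _; exists set0;
     rewrite sub0set cards0 mul0n set0U).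
  by move: lt_MF; rewrite ltnNge (leq_trans le_Fm).
have [v vF deg_v] := deg F FU lt_MF.
pose F0 := F :\ v; pose F1 := F0 :\: [set u | adj v u].
have lt_F0 : #|F0| < #|F| by rewrite [ltnRHS](cardsD1 v) vF.
have F1F0 : F1 \subset F0 by apply: subsetDl.
have F0F : F0 \subset F by apply: subsetDl.
have card_F1 : D + #|F1| <= #|F|.
  have sub : [set u in F | adj v u] \subset v |: (F :&: [set u | adj v u]).
    by apply/subsetP => u; rewrite !inE => ->; rewrite orbT.
  have F1E : F1 = F0 :\: (F :&: [set u | adj v u]).
    by apply/setP => u; rewrite !inE; case: (u \in F); rewrite /= ?andbF.
  have := cardsID (F :&: [set u | adj v u]) F.
  rewrite (setIidPr (subsetIl _ _)).
  have := subset_leq_card sub; rewrite cardsU1.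
  have : #|F1| <= #|F :\: (F :&: [set u | adj v u])|.
    by rewrite F1E subset_leq_card // setSD.
  by case: (v \notin _); lia.
have [g0 g0M g0P] := IHm F0 (subset_trans F0F FU) (leq_trans lt_F0 le_Fm).
have [||g1 g1M g1P] := IHm F1.
- exact: subset_trans F1F0 (subset_trans F0F FU).
- by rewrite -ltnS; apply: leq_trans le_Fm; apply: leq_ltn_trans lt_F0;
     apply: subset_leq_card.
(* Membership of v in the fingerprint tells in which of F0, F1 to go on. *)
exists (fun S : {set V} => if v \in S then g1 (S :\ v) else g0 S).
  by move=> S; case: ifP.
move=> I IF indep; have [vI|nvI] := boolP (v \in I); last first.
  have [|//|S [SI cardS IS]] := g0P I; first by rewrite subsetD1 IF.
  exists S; split=> //; first exact: leq_trans cardS (ltnW lt_F0).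
  by rewrite (negPf (contraNN (subsetP SI v) nvI)).
have [||S [SI cardS IS]] := g1P (I :\ v).
- apply/subsetP => u; rewrite !inE => /andP[-> uI].
  by rewrite (subsetP IF) // (indep v u).
- by move=> u w /setD1P[_ uI] /setD1P[_ wI]; apply: indep.
have nvS : v \notin S by apply/negP => /(subsetP SI); rewrite !inE eqxx.
exists (v |: S); split.
- by rewrite subUset sub1set vI (subset_trans SI) // subsetDl.
- by rewrite cardsU1 nvS mulSn; apply: leq_trans card_F1; rewrite leq_add2l.
- rewrite setU11 setU1K // -setUA -(setD1K vI).
  exact: setUS.
Qed.

Definition antichain (T : finType) (F : {set {set T}}) :=
  {in F &, forall A B : {set T}, ~~ (A \proper B)}.

(** The families of at most 2^n / D sets. *)
Definition fingerprints n D : {set {set {set 'I_n}}} :=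
  [set S : {set {set 'I_n}} | #|S| * D <= 2 ^ n].

Lemma antichain_containers n D M : 0 < D ->
    n * 'C(n, n %/ 2) < M.+1 * (n - 2 * D) ->
  exists2 K : {set {set 'I_n}} -> {set {set 'I_n}},
    forall S, S \in fingerprints n D -> #|K S| <= 1 + 2 ^ n %/ D + M &
    forall F : {set {set 'I_n}}, antichain F ->
      exists2 S, S \in fingerprints n D & F \subset K S.
Proof.
move=> D_gt0 Mbig; have cardV : #|{set 'I_n}| = 2 ^ n.
  by rewrite -cardsT -powersetT card_powerset cardsT card_ord.
have [|g gM gP] :=
  @independent_containers _ (@set_comparable (ordinal n)) (~: [set set0]) D M.
  move=> F F0 ltMF.
  have [/existsP[v /andP[vF degv]]|no_v] :=
    boolP [exists v in F, D < #|[set u in F | set_comparable v u]|].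
    by exists v.
  have : #|F| * (n - 2 * D) <= n * 'C(n, n %/ 2).
    have := @comparable_supersaturation 'I_n F D.
    rewrite card_ord; apply=> [|A AF].
      by apply/negP => /(subsetP F0); rewrite !inE eqxx.
    rewrite leqNgt; apply: contraNN no_v => degA.
    by apply/existsP; exists A; rewrite AF.
  rewrite leqNgt => /negP[]; apply: leq_trans Mbig _.
  by rewrite leq_mul2r ltMF orbT.
(* The empty set is outside the graph and is added to every container. *)
exists (fun S : {set {set 'I_n}} => set0 |: (S :|: g S)) => [S|F antiF].
  rewrite inE -leq_divRL // => cardS.
  rewrite -addnA cardsU1; apply: leq_add; first by case: (_ \in _).
  apply: leq_trans (leq_card_setU _ _).1 _.
  exact: leq_add cardS (gM S).
have [||S [SF cardS FS]] := gP (F :\ set0).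
- by apply/subsetP => A; rewrite !inE => /andP[].
- move=> A B /setD1P[_ AF] /setD1P[_ BF].
  by rewrite /set_comparable negb_or !antiF.
exists S.
  by rewrite inE; apply: leq_trans cardS _; rewrite -cardV max_card.
apply/subsetP => A AF; rewrite !inE.
have [//|A0] := eqVneq A set0.
by have /(subsetP FS) : A \in F :\ set0; rewrite !inE ?A0.
Qed.

(** A family without (k+1)-chains is a union of k antichains: the level sets of
    the height, which is obtained by peeling off the minimal members. *)
Lemma chain_free_height (T : finType) (k : nat) (F : {set {set T}}) :
    (forall s : seq {set T}, sorted (fun A B : {set T} => A \proper B) s ->
       {subset s <= F} -> size s != k.+1) ->
  exists2 h : {set T} -> nat, {in F, forall A, h A < k} &
    {in F &, forall A B : {set T}, A \proper B -> h A < h B}.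
Proof.
elim: k F => [|k IHk] F chainF.
  suff F0 : F = set0 by exists (fun=> 0) => [A|A B]; rewrite F0 inE.
  apply/setP => A; rewrite inE; apply/negP => AF.
  suff: size [:: A] != 1 by [].
  by apply: chainF => // B; rewrite inE => /eqP->.
pose F' := [set B in F | [exists A in F, A \proper B]].
have [|h hk hP] := IHk F'.
  case=> [//|B s] sorted_s sF'; apply/negP => size_s.
  have : B \in F' by rewrite sF' ?mem_head.
  rewrite inE => /andP[BF /existsP[A /andP[AF AB]]].
  suff: size (A :: B :: s) != k.+2.
    by rewrite /= eqSS -[_ == _]/(size (B :: s) == k.+1) size_s.
  apply: chainF => [|C]; first by rewrite /= AB.
  rewrite inE => /orP[/eqP->//|/sF'].
  by rewrite inE => /andP[].
exists (fun A => if A \in F' then (h A).+1 else 0) => [A AF|A B AF BF AB].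
  by case: ifP => // AF'; rewrite ltnS hk.
have BF' : B \in F' by rewrite inE BF; apply/existsP; exists A; rewrite AF.
by rewrite BF'; case: ifP => // AF'; rewrite ltnS hP.
Qed.

Lemma leq_cube_exp3 d : d ^ 3 <= 3 ^ d.
Proof.
case: d => [|[|[|d]]] //; elim: d => [//|d IHd].
rewrite (expnS 3); apply: leq_trans (leq_mul (leqnn 3) IHd).
by rewrite !expnS expn0; nia.
Qed.

(** The number of colourings is cubed so that the bound d^3 <= 3^d on the number
    of colours available to a set can be used in the natural numbers. *)
Lemma rk_colourings_containers n r k (F : {set {set 'I_n}}) D M
    (K : {set {set 'I_n}} -> {set {set 'I_n}}) :
    (forall S, S \in fingerprints n D -> #|K S| <= M) ->
    (forall G : {set {set 'I_n}}, antichain G ->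
      exists2 S, S \in fingerprints n D & G \subset K S) ->
  nb_rk_colourings r k.+1 F ^ 3
    <= (#|fingerprints n D| ^ 3 * 3 ^ M) ^ (r * k).
Proof.
move=> KM KP; set fp := fingerprints n D in KM KP *.
pose X := {A : {set 'I_n} | A \in F}.
pose Y := {ffun 'I_r * 'I_k -> {set {set 'I_n}}}.
(* t (j, i) is the fingerprint of the i-th antichain of colour class j. *)
pose fits (t : Y) (A : X) (j : 'I_r) :=
  [exists i : 'I_k, val A \in K (t (j, i))].
pose nb (t : Y) := #|[set c : {ffun X -> 'I_r} | [forall A, fits t A (c A)]]|.
have nb_prod t : nb t = \prod_(A : X) #|[pred j | fits t A j]|.
  rewrite /nb cardsE -[RHS]big_enum -(big_map _ predT id) -foldrE.
  rewrite -(card_family (fun A : X => [pred j | fits t A j])).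
  by apply: eq_card => c; apply/forallP/familyP.
have nb_bound t : t \in ffun_on fp -> nb t ^ 3 <= 3 ^ (r * k * M).
  move=> /ffun_onP tP; rewrite nb_prod.
  apply: (@leq_trans (\prod_(A : X) 3 ^ #|[pred j | fits t A j]|)).
    rewrite (big_morph (fun x => x ^ 3) (fun x y => expnMn x y 3) (exp1n 3)).
    by apply: leq_prod => A _; apply: leq_cube_exp3.
  rewrite -expn_sum leq_exp2l //.
  apply: (@leq_trans (\sum_(A : X) \sum_(p : 'I_r * 'I_k) (val A \in K (t p)))).
    apply: leq_sum => A _; rewrite -sum1_card big_mkcond /=.
    have -> : \sum_(p : 'I_r * 'I_k) (val A \in K (t p)) =
              \sum_(j < r) \sum_(i < k) (val A \in K (t (j, i))).
      by rewrite pair_bigA; apply: eq_bigr => -[].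
    apply: leq_sum => j _; rewrite unfold_in /=; case: ifP => // /existsP[i iA].
    by rewrite (bigD1 i) //= iA.
  rewrite exchange_big /=.
  apply: (@leq_trans (\sum_(p : 'I_r * 'I_k) M)); last first.
    by rewrite sum_nat_const card_prod !card_ord.
  apply: leq_sum => p _; apply: leq_trans (KM _ (tP p)).
  rewrite -big_mkcond sum1_card -(card_image val_inj) subset_leq_card //.
  by apply/subsetP => A /imageP[B BK ->].
have le_nb : nb_rk_colourings r k.+1 F <= \sum_(t in ffun_on fp) nb t.
  rewrite /nb_rk_colourings.
  have sub : [set c : {ffun X -> 'I_r} | rk_colouring k.+1 c] \subset
     \bigcup_(t in ffun_on fp)
       [set c : {ffun X -> 'I_r} | [forall A, fits t A (c A)]].
    apply/subsetP => c; rewrite inE => /forallP rk_c.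
    have class_cover (j : 'I_r) : exists S : {ffun 'I_k -> {set {set 'I_n}}},
        (forall i, S i \in fp) /\
        (forall A : X, c A = j -> exists i, val A \in K (S i)).
      pose G := [set val A | A in [set A : X | c A == j]].
      have [s sorted_s sG|h hk hP] := @chain_free_height _ k G.
        apply/eqP => size_s.
        have [s' eq_s] : exists s' : seq X, s = map val s'.
          have /subset_mapP/= :
              {subset s <= map val (enum [set A : X | c A == j])}.
            move=> A /sG /imsetP[B Bj ->].
            by apply/mapP; exists B; rewrite // mem_enum.
          by case=> s' _ ->; exists s'.
        have size_s' : size s' == k.+1 by rewrite -size_s eq_s size_map.
        have /implyP := rk_c (Tuple size_s').
        case/(_ _)/negP; first by rewrite eq_s sorted_map in sorted_s.
        have : all (pred1 j) (map c s').
          apply/allP => _ /mapP[A As ->] /=.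
          have /sG/imsetP[B] : val A \in s by rewrite eq_s map_f.
          by rewrite inE => /eqP <- /val_inj ->.
        rewrite /monochromatic /=; case: (map c s') => //= a l /andP[/eqP-> aj].
        exact: aj.
      pose level (i : 'I_k) := [set A in G | h A == i].
      have levelP i : exists2 S, S \in fp & level i \subset K S.
        apply: KP => A B; rewrite !inE => /andP[AG /eqP hA] /andP[BG /eqP hB].
        by apply/negP => AB; have := hP _ _ AG BG AB; rewrite hA hB ltnn.
      have [S SP] := fin_all_exists2 levelP.
      move=> SK; exists [ffun i => S i].
      split=> [i|A cA]; first by rewrite ffunE.
      have AG : val A \in G by apply/imsetP; exists A; rewrite ?inE ?cA.
      exists (Ordinal (hk _ AG)); rewrite ffunE; apply: (subsetP (SK _)).
      by rewrite inE AG /=.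
    have [S SP] := fin_all_exists class_cover.
    apply/bigcupP; exists [ffun p => S p.1 p.2].
      by apply/ffun_onP => p; rewrite ffunE; have [] := SP p.1.
    rewrite inE; apply/forallP => A; apply/existsP.
    by have [_ /(_ A erefl)[i iA]] := SP (c A); exists i; rewrite ffunE.
  apply: leq_trans (subset_leq_card sub) _.
  elim/big_ind2: _ => [|m A m' B le_m le_m'|//]; first by rewrite cards0.
  by apply: leq_trans (leq_card_setU _ _).1 (leq_add le_m le_m').
have max_bound : (\max_(t in ffun_on fp) nb t) ^ 3 <= 3 ^ (r * k * M).
  elim/big_ind: _ => [|x y|t]; [by rewrite exp0n| |exact: nb_bound].
  by rewrite /maxn; case: ifP.
apply: (@leq_trans ((#|fp| ^ (r * k) * \max_(t in ffun_on fp) nb t) ^ 3)).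
  rewrite leq_exp2r //; apply: leq_trans le_nb _.
  apply: (@leq_trans (\sum_(t in ffun_on fp) \max_(t in ffun_on fp) nb t)).
    by apply: leq_sum => t tfp; apply: leq_bigmax_cond.
  by rewrite sum_nat_const card_ffun_on card_prod !card_ord.
have -> : (#|fp| ^ 3 * 3 ^ M) ^ (r * k) =
          (#|fp| ^ (r * k)) ^ 3 * 3 ^ (r * k * M).
  by rewrite expnMn -!expnM (mulnC 3 (r * k)) (mulnC M (r * k)).
by rewrite expnMn leq_mul.
Qed.

End Containers.

(** * Colouring the middle layers from lists *)

Section Layers.
Local Open Scope nat_scope.

(** The colour list of the i-th layer.  The integers x < r * k are the slots:
    slot x belongs to layer x %/ 3 and carries colour x %% r, so that every
    layer below r * k %/ 3 has three slots and every colour has k slots. *)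
Definition layer_colours r k i : {set 'I_r} :=
  [set j : 'I_r | [exists q : 'I_k, (r * q + j) %/ 3 == i]].

Lemma card_layer_colours r k i : 3 <= r -> 3 * i.+1 <= r * k ->
  3 <= #|layer_colours r k i|.
Proof.
move=> r_ge3 le_i; have r_gt0 : 0 < r by apply: leq_trans r_ge3.
(* As r >= 3, three consecutive slots carry distinct colours. *)
pose f (e : 'I_3) := Ordinal (ltn_pmod (3 * i + e) r_gt0).
have f_inj : injective f.
  move=> e e' /(congr1 val)/= /eqP; rewrite eqn_modDl => /eqP.
  rewrite !modn_small ?(leq_trans _ r_ge3) // => /val_inj; exact.
rewrite -[leqLHS](card_ord 3) -(card_image f_inj) subset_leq_card //.
apply/subsetP => _ /imageP[e _ ->]; rewrite inE; apply/existsP.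
have lt_q : (3 * i + e) %/ r < k.
  by rewrite ltn_divLR // mulnC; have := ltn_ord e; lia.
exists (Ordinal lt_q) => /=; rewrite [r * _]mulnC -divn_eq.
by rewrite mulnC divnMDl // divn_small ?addn0.
Qed.

Lemma card_middle_layers n h m :
  #|[set A : {set 'I_n} | h <= #|A| < h + m]| = \sum_(i < m) 'C(n, h + i).
Proof.
elim: m => [|m IHm].
  rewrite big_ord0; apply/eqP; rewrite cards_eq0; apply/eqP/setP => A.
  by rewrite !inE; apply/negP => /andP[]; lia.
rewrite big_ord_recr /= -IHm -[n in 'C(n, _)](card_ord n) -card_draws -cardsUI.
rewrite -[LHS]addn0; congr (_ + _).
  by apply: eq_card => A; rewrite !inE; move: #|A| => a; apply/idP/idP; lia.
apply/esym/eqP; rewrite cards_eq0; apply/eqP/setP => A.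
by rewrite !inE; apply/negP => /andP[/andP[_ ltA] /eqP eqA];
   rewrite eqA ltnn in ltA.
Qed.

Lemma middle_layers_colourings n r k m : 3 <= r -> 3 * m <= r * k ->
  3 ^ (\sum_(i < m) 'C(n, n %/ 2 + i)) <= max_rk_colourings r k.+1 n.
Proof.
move=> r_ge3 le_m; set h := n %/ 2.
pose F := [set A : {set 'I_n} | h <= #|A| < h + m].
apply: leq_trans (leq_bigmax F); rewrite -card_middle_layers -/F.
pose X := {A : {set 'I_n} | A \in F}.
pose colours (A : X) := layer_colours r k (#|val A| - h).
apply: (@leq_trans #|family colours|).
  rewrite card_family foldrE big_map big_enum /=.
  apply: (@leq_trans (\prod_(A : X) 3)).
    rewrite prod_nat_const leq_exp2l //.
    by rewrite card_sig leq_eqVlt (eq_card (B := mem F)) ?eqxx.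
  apply: leq_prod => A _; apply: card_layer_colours => //.
  apply: leq_trans le_m; rewrite leq_mul2l /=.
  have := valP A; rewrite inE => /andP[le_h lt_h].
  by rewrite -subSn // leq_subLR.
apply: subset_leq_card; apply/subsetP => c /familyP cP; rewrite inE.
apply/forallP => t; apply/implyP => chain_t; apply/negP => mono_t.
have [A0 tA0] : exists A0, A0 \in t.
  by case/tupleP: t {chain_t mono_t} => A0 t; exists A0; rewrite mem_head.
have mono A : A \in t -> c A = c A0.
  move=> tA; have /constantP := mono_t; move=> /(_ (c A0))[x eq_x].
  have nseqP B : B \in t -> c B = x.
    by move=> /(map_f c); rewrite eq_x mem_nseq => /andP[_ /eqP].
  by rewrite !nseqP.
(* The sizes of the sets of a chain are distinct, but a colour occurs in the
   lists of at most k layers. *)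
pose sizes := [seq h + (r * q + c A0) %/ 3 | q : 'I_k].
have sub : {subset [seq #|val A| | A : X <- tval t] <= sizes}.
  move=> _ /mapP[A tA ->]; have := cP A; rewrite inE => /existsP[q /eqP eq_q].
  apply/mapP; exists q; rewrite ?mem_enum // -(mono A tA) eq_q.
  by have := valP A; rewrite inE => /andP[/subnKC].
have uniq_sizes : uniq [seq #|val A| | A : X <- tval t].
  apply: (@sorted_uniq _ ltn); [exact: ltn_trans|exact: ltnn|].
  rewrite sorted_map; apply: sub_sorted chain_t => A B; exact: proper_card.
have := uniq_leq_size uniq_sizes sub.
by rewrite size_map size_tuple size_image card_ord ltnn.
Qed.

End Layers.

(** * The number of fingerprints *)

Section Estimates.
Variable R : realType.

(** Weighting S by t^(- #|S|), of total (1 + 1/t)^(2^n) over all families S,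
    bounds the number of those with few members. *)
Lemma card_fingerprints n D (t : R) : (0 < D)%N -> 1 <= t ->
  #|fingerprints n D|%:R <= t ^+ (2 ^ n %/ D) * (1 + t^-1) ^+ (2 ^ n).
Proof.
move=> D_gt0 t_ge1; have t_gt0 : 0 < t by apply: lt_le_trans t_ge1.
have tV_ge0 : 0 <= t^-1 by rewrite invr_ge0 ltW.
have -> : (1 + t^-1) ^+ (2 ^ n) = \sum_(S : {set {set 'I_n}}) t^-1 ^+ #|S|.
  have cardV : #|{set 'I_n}| = (2 ^ n)%N.
    by rewrite -cardsT -powersetT card_powerset cardsT card_ord.
  rewrite -cardV -prodr_const addrC bigA_distr; apply: eq_bigr => S _.
  by rewrite -big_mkcond prodr_const.
set s := (2 ^ n %/ D)%N.
rewrite mulrC -ler_pdivrMr ?exprn_gt0 // mulr_natl -exprVn -sumr_const.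
rewrite [leRHS](bigID (mem (fingerprints n D))) /= -[leLHS]addr0.
apply: lerD; last by apply: sumr_ge0 => S _; apply: exprn_ge0.
apply: ler_sum => S; rewrite inE -leq_divRL // => le_S.
by apply: ler_wiXn2l => //; rewrite invf_le1.
Qed.

Lemma expR_powR3 (x : R) : expR x = 3 `^ (x / ln 3).
Proof.
have ln3 : 0 < ln 3 :> R by rewrite ln_gt0 // ltr1n.
by rewrite /powR pnatr_eq0 /= mulfVK // gt_eqF.
Qed.

(** Here y is the fourth root of n; the bound n <= expR (4 y) takes the place of
    an estimate of ln n. *)
Lemma card_fingerprints_powR3 n q : (0 < q)%N -> (q <= n)%N ->
  let N := (2 ^ n)%:R : R in let y := Num.sqrt (Num.sqrt n%:R) in
  #|fingerprints n (n %/ q)|%:R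
    <= 3 `^ ((N / n%:R * (8 * q%:R * y + 1)) / ln 3) :> R /\
  (2 ^ n %/ (n %/ q))%:R <= N / n%:R * (2 * q%:R) :> R.
Proof.
move=> q_gt0 le_qn N y; set D := (n %/ q)%N.
have n_gt0 : (0 < n)%N by apply: leq_trans le_qn.
have D_gt0 : (0 < D)%N by rewrite divn_gt0.
have nR_gt0 : 0 < n%:R :> R by rewrite ltr0n.
have y_gt0 : 0 < y by rewrite !sqrtr_gt0.
have y4 : n%:R = y ^+ 4.
  by rewrite /y (exprM _ 2 2) !sqr_sqrtr ?sqrtr_ge0 ?ler0n.
have s_le : (2 ^ n %/ D)%:R <= N / n%:R * (2 * q%:R) :> R.
  rewrite mulrAC ler_pdivlMr // -!natrM ler_nat.
  have le_n : (n <= 2 * q * D)%N.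
    have := divn_eq n q; have := ltn_pmod n q_gt0; rewrite -/D.
    have := leq_mul (leqnn q) D_gt0; lia.
  apply: leq_trans (leq_mul (leqnn _) le_n) _.
  by have := leq_divM (2 ^ n) D; nia.
split=> //; rewrite -expR_powR3.
apply: le_trans (card_fingerprints _ D_gt0 (_ : 1 <= n%:R)) _.
  by rewrite ler1n.
rewrite mulrDr mulr1 expRD; apply: ler_pM.
- by rewrite exprn_ge0.
- by rewrite exprn_ge0 // addr_ge0 // invr_ge0.
- rewrite {1}y4 -exprM.
  apply: (@le_trans _ _ (expR y ^+ (4 * (2 ^ n %/ D)))).
    rewrite lerXn2r ?nnegrE ?expR_ge0 ?(ltW y_gt0) //.
    by apply: le_trans (expR_ge1Dx y); rewrite lerDr.
  rewrite -expRM_natr ler_expR natrM.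
  have := ler_wpM2l (ltW y_gt0) s_le; nra.
- apply: (@le_trans _ _ (expR n%:R^-1 ^+ (2 ^ n))).
    rewrite lerXn2r ?nnegrE ?expR_ge0 ?expR_ge1Dx //.
    by rewrite addr_ge0 // invr_ge0.
  by rewrite -expRM_natr mulrC.
Qed.

(** For fixed q, the cube of the number of fingerprints of size O(q 2^n / n), as
    well as this size itself, are absorbed by an error term delta 'C(n, n %/ 2)
    in the exponent. *)
Lemma fingerprints_negligible q (delta : R) : (0 < q)%N -> 0 < delta ->
  exists n0 : nat, forall n, (n0 <= n)%N ->
    (q <= n)%N /\ exists2 L : R,
      #|fingerprints n (n %/ q)|%:R <= 3 `^ L &
      3 * L + 1 + (2 ^ n %/ (n %/ q))%:R <= delta * 'C(n, n %/ 2)%:R.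
Proof.
move=> q_gt0 delta_gt0; pose lam : R := (ln 3)^-1.
have lam_gt0 : 0 < lam by rewrite invr_gt0 ln_gt0 // ltr1n.
pose c : R := 3 * lam * (8 * q%:R + 1) + 1 + 2 * q%:R.
have qR_gt0 : 0 < q%:R :> R by rewrite ltr0n.
have c_gt0 : 0 < c by rewrite /c; nra.
exists (maxn q (Num.bound ((2 * c / delta) ^+ 4))) => n.
rewrite geq_max => /andP[le_qn le_cn]; split=> //.
have [] := card_fingerprints_powR3 q_gt0 le_qn.
set N : R := (2 ^ n)%:R; set y := Num.sqrt _; set L := _ / ln 3.
set s := (2 ^ n %/ _)%:R => le_fp le_s; exists L => //.
have n_gt0 : (0 < n)%N by apply: leq_trans le_qn.
have nR_ge1 : 1 <= n%:R :> R by rewrite ler1n.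
have y_gt0 : 0 < y by rewrite !sqrtr_gt0 (lt_le_trans _ nR_ge1).
have y4 : n%:R = y ^+ 4.
  by rewrite /y (exprM _ 2 2) !sqr_sqrtr ?sqrtr_ge0 ?ler0n.
have y_ge1 : 1 <= y.
  rewrite leNgt; apply/negP => y_lt1; move: nR_ge1.
  by rewrite y4 leNgt exprn_ilt1 // ltW.
have N_ge : n%:R <= N by rewrite ler_nat ltnW // ltn_expl.
have nR_gt0 : 0 < n%:R :> R by apply: lt_le_trans nR_ge1.
have z_ge1 : 1 <= N / n%:R by rewrite ler_pdivlMr ?mul1r.
set z := N / n%:R in z_ge1 L le_fp le_s *.
have N_z : N = z * y ^+ 4 by rewrite -y4 /z mulfVK // gt_eqF.
have le_c : 2 * c <= delta * y.
  rewrite -ler_pdivrMl // mulrC -(@ler_pXn2r _ 4) ?nnegrE ?(ltW y_gt0) //;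
    last first.
    by rewrite divr_ge0 ?(ltW delta_gt0) // mulr_ge0 // ltW.
  rewrite -y4; apply: ltW; apply: lt_le_trans (archi_boundP _) _.
    by rewrite exprn_ge0 // divr_ge0 ?(ltW delta_gt0) // mulr_ge0 // ltW.
  by rewrite ler_nat.
have C_ge : N <= 2 * y ^+ 2 * 'C(n, n %/ 2)%:R.
  rewrite -(@ler_pXn2r _ 2) ?nnegrE ?mulr_ge0 ?exprn_ge0 ?(ltW y_gt0) //.
  have := central_bin_lower n_gt0; rewrite -(ler_nat R) => le4.
  have -> : N ^+ 2 = (4 ^ n)%:R by rewrite -natrX -expnM mulnC expnM.
  apply: le_trans le4 _.
  have -> : (2 * y ^+ 2 * 'C(n, n %/ 2)%:R) ^+ 2 =
            4 * n%:R * 'C(n, n %/ 2)%:R ^+ 2.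
    by rewrite y4; ring.
  rewrite -natrX -!natrM ler_nat.
  rewrite leq_mul2r -[4%N]/(2 * 2)%N -mulnA leq_mul2l.
  by rewrite [(2 * n)%N]mul2n -addnn -[(n < _)%N]/(1 + n <= _)%N
             leq_add2r n_gt0 !orbT.
apply: (@le_trans _ _ (c * (z * y))).
  have zy : z <= z * y by rewrite ler_peMr // (le_trans _ z_ge1).
  have -> : L = z * (8 * q%:R * y + 1) * lam by [].
  have zy1 : 1 <= z * y by apply: le_trans z_ge1 zy.
  have zq : z * q%:R <= z * y * q%:R by rewrite ler_wpM2r.
  have zl : z * lam <= z * y * lam by rewrite ler_wpM2r // ltW.
  by rewrite /c; lra.
have y2_gt0 : 0 < 2 * y ^+ 2 by rewrite mulr_gt0 // exprn_gt0.
rewrite -(ler_pM2l y2_gt0) [leRHS]mulrCA.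
apply: le_trans (ler_wpM2l (ltW delta_gt0) C_ge).
have zy3_ge0 : 0 <= z * y ^+ 3.
  by rewrite mulr_ge0 ?exprn_ge0 ?(ltW y_gt0) // (le_trans _ z_ge1).
have -> : 2 * y ^+ 2 * (c * (z * y)) = 2 * c * (z * y ^+ 3) by ring.
have -> : delta * N = delta * y * (z * y ^+ 3) by rewrite N_z; ring.
by rewrite ler_wpM2r.
Qed.

End Estimates.

(** * The two bounds *)

Section Bounds.
Variable R : realType.

(** The ratio of consecutive binomial coefficients among the m layers above the
    middle is at least 1 - a, with a = 2 m / (n %/ 2 + 1). *)
Lemma bin_near_half n m i : (2 * m <= n %/ 2)%N -> (i <= m)%N ->
  (1 - i%:R * (2 * m%:R / (n %/ 2).+1%:R)) * 'C(n, n %/ 2)%:R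
    <= 'C(n, n %/ 2 + i)%:R :> R.
Proof.
set h := (n %/ 2)%N => le_mh; set a := 2 * m%:R / h.+1%:R.
have hR_gt0 : 0 < h.+1%:R :> R by rewrite ltr0n.
have a_ge0 : 0 <= a by rewrite divr_ge0 // mulr_ge0.
have a_le1 : a <= 1 by rewrite ler_pdivrMr // mul1r -natrM ler_nat leqW.
elim: i => [|i IHi] lt_im; first by rewrite mul0r subr0 mul1r addn0.
have step : (1 - a) * 'C(n, h + i)%:R <= 'C(n, h + i.+1)%:R :> R.
  have := mul_bin_left n (h + i); rewrite -addnS => eq_bin.
  have hi_gt0 : 0 < (h + i.+1)%:R :> R by rewrite ltr0n addnS.
  rewrite -(ler_pM2l hi_gt0) -natrM {}eq_bin natrM mulrA ler_wpM2r //.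
  apply: (@le_trans _ _ (h - i)%:R); last by rewrite ler_nat /h; lia.
  rewrite natrB; last by lia.
  have : a * (h%:R + 1) = 2 * m%:R by rewrite natr1 mulfVK // gt_eqF.
  have : 2 * i%:R + 1 <= 2 * m%:R :> R by rewrite -!natrM natr1 ler_nat; lia.
  rewrite natrD -natr1.
  have := mulr_ge0 a_ge0 (ler0n R i); nra.
apply: le_trans step.
have := ler_wpM2l (_ : 0 <= 1 - a) (IHi (ltnW lt_im)).
rewrite subr_ge0 => /(_ a_le1); apply: le_trans.
rewrite [leRHS]mulrA ler_wpM2r // -natr1.
have := mulr_ge0 (ler0n R i) (mulr_ge0 a_ge0 a_ge0); nra.
Qed.

Lemma max_rk_colourings_lower r k (eps : R) : (3 <= r)%N -> 0 < eps ->
    (3 %| r * k)%N ->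
  exists n0 : nat, forall n, (n0 <= n)%N ->
    3 `^ (1 / 3 * r%:R * (k%:R - eps) * 'C(n, n %/ 2)%:R)
      <= (max_rk_colourings r k.+1 n)%:R :> R.
Proof.
move=> r_ge3 eps_gt0 /dvdnP[m eq_rk].
have reps_gt0 : 0 < r%:R * eps by rewrite mulr_gt0 // ltr0n (leq_trans _ r_ge3).
pose b : R := 12 * m%:R ^+ 3 / (r%:R * eps).
have b_ge0 : 0 <= b by rewrite divr_ge0 ?mulr_ge0 ?exprn_ge0 // ltW.
exists (maxn (4 * m).+2 (Num.bound b)) => n.
rewrite geq_max => /andP[le_mn le_bn].
have le_m : (2 * m <= n %/ 2)%N by lia.
apply: le_trans (_ : (3 ^ \sum_(i < m) 'C(n, n %/ 2 + i))%:R <= _); last first.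
  by rewrite ler_nat; apply: middle_layers_colourings; rewrite // eq_rk mulnC.
rewrite natrX -powR_mulrn //; apply: ler_powR; first by rewrite ler1n.
set a : R := 2 * m%:R / (n %/ 2).+1%:R.
have a_ge0 : 0 <= a by rewrite divr_ge0 // mulr_ge0.
apply: (@le_trans _ _ (m%:R * ((1 - m%:R * a) * 'C(n, n %/ 2)%:R))).
  rewrite mulrA ler_wpM2r //.
  have eqR : r%:R * k%:R = 3 * m%:R :> R by rewrite -!natrM eq_rk mulnC.
  suff : m%:R * m%:R * a * 3 <= r%:R * eps by nra.
  have hR_gt0 : 0 < (n %/ 2).+1%:R :> R by rewrite ltr0n.
  have le_nh : n%:R <= 2 * (n %/ 2).+1%:R :> R by rewrite -natrM ler_nat; lia.
  have : b <= n%:R.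
    by apply: le_trans (ltW (archi_boundP b_ge0)) _; rewrite ler_nat.
  rewrite ler_pdivrMr // => le_b.
  have -> : m%:R * m%:R * a * 3 = 6 * m%:R ^+ 3 / (n %/ 2).+1%:R.
    by rewrite /a; ring.
  rewrite ler_pdivrMr //.
  have := ler_wpM2r (ltW reps_gt0) le_nh; lra.
rewrite natr_sum mulr_natl -[X in _ *+ X]card_ord -sumr_const.
apply: ler_sum => i _; apply: le_trans (bin_near_half le_m (ltnW (ltn_ord i))).
rewrite ler_wpM2r // lerD2l lerN2 ler_wpM2r // ler_nat.
exact: ltnW.
Qed.

Lemma max_rk_colourings_upper r k (eps : R) : (0 < k)%N -> 0 < eps ->
  exists n0 : nat, forall n, (n0 <= n)%N ->
    (max_rk_colourings r k.+1 n)%:R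
      <= 3 `^ (1 / 3 * r%:R * (k%:R + eps) * 'C(n, n %/ 2)%:R) :> R.
Proof.
move=> k_gt0 eps_gt0; have kR_gt0 : 0 < k%:R :> R by rewrite ltr0n.
(* The error eps / k allowed for one antichain is shared equally between the
   size of the container and the fingerprint. *)
pose delta := eps / (2 * k%:R).
have delta_gt0 : 0 < delta by rewrite divr_gt0 // mulr_gt0.
pose p := (Num.bound (2 / delta)).+1; pose q := p.+2.
have le_p : 2 <= delta * p%:R.
  rewrite -ler_pdivrMl // mulrC ltW //.
  apply: lt_le_trans (archi_boundP _) _; first by rewrite divr_ge0 // ltW.
  by rewrite ler_nat.
have [n0 n0P] := @fingerprints_negligible R q delta isT delta_gt0.
exists n0 => n /n0P[le_qn [L le_fp le_L]].
set D := (n %/ q)%N in le_fp le_L *; set C := 'C(n, n %/ 2) in le_L *.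
have D_gt0 : (0 < D)%N by rewrite divn_gt0.
have le_Dq : (D * q <= n)%N by apply: leq_divM.
have lt_Dn : (0 < n - 2 * D)%N.
  by rewrite subn_gt0 (leq_trans _ le_Dq) // mulnC ltn_pmul2l.
pose M := (n * C %/ (n - 2 * D))%N.
have [K KM KP] := @antichain_containers n D M D_gt0 (ltn_ceil _ lt_Dn).
(* With D <= n / q, the factor n / (n - 2 D) is at most q / (q - 2) =
   1 + 2 / p <= 1 + delta. *)
have M_le : M%:R <= (1 + delta) * C%:R.
  have pR_gt0 : 0 < p%:R :> R by rewrite ltr0n.
  have : (M * p <= C * q)%N.
    have := leq_divM (n * C) (n - 2 * D); rewrite -/M => le_M.
    rewrite -(leq_pmul2l lt_Dn).
    apply: (@leq_trans (n * C * p)).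
      by rewrite mulnA leq_mul2r mulnC le_M orbT.
    rewrite -mulnA mulnCA [leqRHS]mulnCA leq_mul2l; apply/orP; right.
    have eq_nq : (n * q = n * p + 2 * n)%N.
      by rewrite /q -addn2 mulnDr [(n * 2)%N]mulnC.
    rewrite mulnBl eq_nq -(mulnA 2).
    by rewrite -addnBA ?leq_addr // leq_mul2l le_Dq orbT.
  rewrite -(ler_nat R) !natrM /q -[p.+2]addn2 natrD => le_Mp.
  rewrite -(ler_pM2r pR_gt0); apply: le_trans le_Mp _.
  have := ler_wpM2r (ler0n R C) le_p; nra.
have nb_le (F : {set {set 'I_n}}) : (nb_rk_colourings r k.+1 F)%:R
    <= 3 `^ (1 / 3 * r%:R * (k%:R + eps) * C%:R) :> R.
  have := @rk_colourings_containers n r k F D _ K KM KP.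
  rewrite -(ler_nat R) => le_nb.
  rewrite -(@ler_pXn2r _ 3) ?nnegrE ?powR_ge0 // -natrX.
  apply: le_trans le_nb _; rewrite natrX natrM !natrX.
  rewrite -[leRHS]powR_mulrn ?powR_ge0 // -powRrM.
  apply: (@le_trans _ _ ((3 `^ (L * 3 + (1 + 2 ^ n %/ D + M)%:R)) ^+ (r * k))).
    rewrite lerXn2r ?nnegrE ?powR_ge0 ?mulr_ge0 ?exprn_ge0 //.
    rewrite powRD ?pnatr_eq0 ?implybT // powR_mulrn //.
    by rewrite powRrM powR_mulrn ?powR_ge0 // ler_wpM2r ?exprn_ge0 //
               lerXn2r ?nnegrE ?powR_ge0.
  rewrite -powR_mulrn ?powR_ge0 // -powRrM.
  apply: ler_powR; first by rewrite ler1n.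
  rewrite !natrD natrM.
  have main : k%:R * (L * 3 + (1 + (2 ^ n %/ D)%:R + M%:R))
      <= (k%:R + eps) * C%:R.
    have le_sum : L * 3 + (1 + (2 ^ n %/ D)%:R + M%:R)
        <= (1 + delta + delta) * C%:R.
      lra.
    apply: le_trans (ler_wpM2l (ltW kR_gt0) le_sum) _.
    rewrite mulrA ler_wpM2r //.
    have : delta * (2 * k%:R) = eps by rewrite mulfVK // gt_eqF // mulr_gt0.
    lra.
  have := ler_wpM2l (ler0n R r) main; lra.
rewrite /max_rk_colourings; elim/big_ind: _ => // [|x y xP yP].
  exact: powR_ge0.
by rewrite /maxn; case: ifP.
Qed.

End Bounds.

Theorem proposition1p3 (R : realType) (k r : nat) (eps : R) :
  (2 <= k)%N -> (3 <= r)%N -> 0 < eps ->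
  exists n0 : nat, forall n : nat, (n0 <= n)%N ->
    (max_rk_colourings r k n)%:R
      <= (3 : R) `^ (1 / 3 * r%:R * (k%:R - 1 + eps) * 'C(n, n %/ 2)%:R)
    /\ ((3 %| r * (k - 1))%N ->
        (3 : R) `^ (1 / 3 * r%:R * (k%:R - 1 - eps) * 'C(n, n %/ 2)%:R)
          <= (max_rk_colourings r k n)%:R).
Proof.
case: k => [//|k]; rewrite ltnS => k_gt0 r_ge3 eps_gt0.
have -> : k.+1%:R - 1 = k%:R :> R by rewrite -natr1 addrK.
rewrite subn1 /=.
have [n1 n1P] := max_rk_colourings_upper r k_gt0 eps_gt0.
have [dvd3|ndvd3] := boolP (3 %| r * k)%N; last first.
  by exists n1 => n /n1P le_n; split.
have [n2 n2P] := max_rk_colourings_lower r_ge3 eps_gt0 dvd3.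
exists (maxn n1 n2) => n; rewrite geq_max => /andP[/n1P le_n /n2P ge_n].
by split.
Qed.
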